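(* There exists a constant $c^{\mathrm{CL}}\ge1$, independent of $m$ and $n$, such that the following holds. Let $m\in\mathbb N$, $m\ge 1$, let $0<\alpha<1$ be fixed, and let $n\in\mathbb N$ satisfy $$n\ge\frac{c^{\mathrm{CL}}}{\alpha}\,m^2\left(\log m+\frac\pi2\right).$$ Then the segmental Lebesgue constant $\Lambda_m(\mathcal S_m^{\mathrm{MC}})$ associated with the concatenated mock-Chebyshev segments $\mathcal S_m^{\mathrm{MC}}=\{s_1^{\mathrm{MC}},\dots,s_m^{\mathrm{MC}}\}$ (extracted from the equispaced grid with $n+1$ nodes) satisfies $$\Lambda_m(\mathcal S_m^{\mathrm{MC}})\le\frac{c^{\mathrm{CL}}}{1-\alpha}\left(\log m+\frac\pi2\right).$$
   Context: Let $I=[-1,1]$, and let $\mathbb P_{m-1}$ be the space of real univariate polynomials of degree at most $m-1$. Equispaced grid: $X_{n+1}^{\mathrm{eq}}=\{x_k=-1+\frac{2k}{n}:k=0,\dots,n\}$. Chebyshev–Lobatto nodes: $x_i^{\mathrm{CL}}=-\cos\left(\frac{\pi (m-i)}{m}\right)$, $i=0,\dots,m$, understood to be indexed in increasing order (i.e. the points $-\cos(\pi i/m)$, $i=0,\dots,m$). Mock-Chebyshev nodes: for each $i=0,\dots,m$, $x_i^{\mathrm{MC}}$ is an element of $X_{n+1}^{\mathrm{eq}}$ closest to $x_i^{\mathrm{CL}}$, i.e. a solution of $\min_{k=0,\dots,n}|x_k-x_i^{\mathrm{CL}}|^2$. Concatenated mock-Chebyshev segments: $s_i^{\mathrm{MC}}=[x_{i-1}^{\mathrm{MC}},x_i^{\mathrm{MC}}]$,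 $i=1,\dots,m$. Segmental Lebesgue constant: a set $\mathcal S=\{s_1,\dots,s_m\}$ of nondegenerate segments in $I$ is unisolvent for $\mathbb P_{m-1}$ if, for a basis $u_1,\dots,u_m$ of $\mathbb P_{m-1}$, the matrix with entries $\frac1{|s_i|}\int_{s_i}u_j(x)\,\mathrm dx$ is nonsingular. In this case the Lagrange basis $\ell_{s_1},\dots,\ell_{s_m}$ of $\mathbb P_{m-1}$ is determined by $\frac1{|s_i|}\int_{s_j}\ell_{s_i}(x)\,\mathrm dx=\delta_{ij}$, and $$\Lambda_m(\mathcal S)=\sup_{s\subset I}\frac1{|s|}\sum_{i=1}^m\left|\int_s\ell_{s_i}(x)\,\mathrm dx\right|=\max_{x\in I}\sum_{i=1}^m|\ell_{s_i}(x)|,$$ where the supremum is over nondegenerate segments $s\subset I$. The constant $c^{\mathrm{CL}}$ in the paper is related to the Lebesgue constant of the Chebyshev segments $\mathcal S_m^{\mathrm{CL}}=\{[x_{i-1}^{\mathrm{CL}},x_i^{\mathrm{CL}}]:i=1,\dots,m\}$, via a bound $\Lambda_m(\mathcal S_m^{\mathrm{CL}})\le c^{\mathrm{CL}}(\log m+\frac\pi2)$ valid for all $m$. *)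

(* Defs.v *)
From HB Require Import structures.
From mathcomp Require Import all_boot all_order all_algebra.
From mathcomp Require Import all_classical all_reals all_analysis.

Set Implicit Arguments.
Unset Strict Implicit.
Unset Printing Implicit Defensive.

Import Order.TTheory GRing.Theory Num.Theory.
Import numFieldNormedType.Exports.
Local Open Scope classical_set_scope.
Local Open Scope ring_scope.

(* A segment [a, b] is encoded by the pair (a, b) of its endpoints. *)
Definition segment (R : realType) : Type := (R * R)%type.

Definition nondegenerate (R : realType) (s : segment R) : Prop := s.1 < s.2.

Definition in_I (R : realType) (s : segment R) : Prop := -1 <= s.1 /\ s.2 <= 1.

Definition seg_length (R : realType) (s : segment R) : R := s.2 - s.1.

Definition seg_int (R : realType) (s : segment R) (p : {poly R}) : R :=
  Rintegral (@lebesgue_measure R) `[s.1, s.2] (fun x => p.[x]).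

(* {poly_m R} is the space of polynomials p with size p <= m, i.e., of degree
   at most m - 1. *)
Definition unisolvent (R : realType) (m : nat) (s : 'I_m -> segment R) : Prop :=
  (forall i, nondegenerate (s i) /\ in_I (s i)) /\
  exists2 u : m.-tuple {poly_m R}, basis_of fullv u &
    \matrix_(i < m, j < m) ((seg_length (s i))^-1 * seg_int (s i) (tnth u j))
      \in unitmx.

Definition is_lagrange_basis (R : realType) (m : nat) (s : 'I_m -> segment R)
    (l : {ffun 'I_m -> {poly_m R}}) : Prop :=
  forall i j, (seg_length (s i))^-1 * seg_int (s j) (l i) = (i == j)%:R.

(* The Lagrange basis; a junk value when there is none.  For a unisolvent s it
   is the only family satisfying is_lagrange_basis: see lagrange_basisP and
   lagrange_basis_unique. *)
Definition lagrange_basis (R : realType) (m : nat) (s : 'I_m -> segment R) :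
    {ffun 'I_m -> {poly_m R}} :=
  xget [ffun=> 0] [set l | is_lagrange_basis s l].

(* Extended-real supremum, so that no boundedness is presupposed. *)
Definition lebesgue_constant (R : realType) (m : nat) (s : 'I_m -> segment R) :
    \bar R :=
  ereal_sup [set ((seg_length t)^-1 *
                   \sum_(i < m) `|seg_int t (lagrange_basis s i)|)%:E
            | t in [set t : segment R | nondegenerate t /\ in_I t]].

Definition equispaced (R : realType) (n k : nat) : R :=
  -1 + 2 * k%:R / n%:R.

(* In increasing order: from -1 for i = 0 to 1 for i = m. *)
Definition cheb_lobatto (R : realType) (m i : nat) : R :=
  - cos (pi * i%:R / m%:R).

(* A closest grid point need not be unique: x is any admissible choice. *)
Definition is_mock_chebyshev (R : realType) (m n : nat) (x : 'I_m.+1 -> R) :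
    Prop :=
  forall i : 'I_m.+1, exists k : 'I_n.+1,
    x i = equispaced R n k /\
    forall k' : 'I_n.+1,
      `|equispaced R n k - cheb_lobatto R m i| ^+ 2 <=
      `|equispaced R n k' - cheb_lobatto R m i| ^+ 2.

(* With 0-based indices, segment number i : 'I_m is [x_i, x_(i+1)]. *)
Definition concatenated (R : realType) (m : nat) (x : 'I_m.+1 -> R) :
    'I_m -> segment R :=
  fun i => (x (widen_ord (leqnSn m) i), x (lift ord0 i)).

Section LagrangeBasis.
Variables (R : realType).

Lemma poly_integrable (a b : R) (p : {poly R}) :
  (@lebesgue_measure R).-integrable `[a, b] (EFin \o (fun x => p.[x])).
Proof.
apply: continuous_compact_integrable; first exact: segment_compact.
by apply: continuous_subspaceT => x; exact: continuous_horner.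
Qed.

Lemma seg_intD (s : segment R) (p q : {poly R}) :
  seg_int s (p + q) = seg_int s p + seg_int s q.
Proof.
rewrite /seg_int -RintegralD//; try exact: poly_integrable.
by apply: eq_Rintegral => x _; rewrite hornerD.
Qed.

Lemma seg_intZ (s : segment R) (c : R) (p : {poly R}) :
  seg_int s (c *: p) = c * seg_int s p.
Proof.
rewrite /seg_int -RintegralZl//; try exact: poly_integrable.
by apply: eq_Rintegral => x _; rewrite hornerZ.
Qed.

Lemma seg_int0 (s : segment R) : seg_int s 0 = 0.
Proof. by rewrite -[0 in LHS](scale0r (0 : {poly R})) seg_intZ mul0r. Qed.

Variables (m : nat) (s : 'I_m -> segment R).

Lemma seg_int_lin (t : segment R) (c : 'I_m -> R) (u : 'I_m -> {poly_m R}) :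
  seg_int t (\sum_j c j *: u j : {poly_m R}) = \sum_j c j * seg_int t (u j).
Proof.
rewrite raddf_sum /=.
elim/big_rec2: _ => [|i y p _ IH]; first exact: seg_int0.
by rewrite seg_intD seg_intZ IH.
Qed.

Lemma lagrange_basisP : unisolvent s -> is_lagrange_basis s (lagrange_basis s).
Proof.
case=> nd [u _ Mu]; set M := (M in M \in _) in Mu.
suff [l hl] : exists l, is_lagrange_basis s l.
  by rewrite /lagrange_basis; case: xgetP => [l' _ //|/(_ l)].
exists [ffun i => \sum_j invmx M j i *: tnth u j] => i j.
rewrite ffunE seg_int_lin.
have L0 k : seg_length (s k) != 0.
  by rewrite /seg_length subr_eq0 gt_eqF//; case: (nd k).
have -> : \sum_k invmx M k i * seg_int (s j) (tnth u k) =
    seg_length (s j) * (j == i)%:R.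
  have /matrixP/(_ j i) := mulmxV Mu; rewrite !mxE => <-.
  rewrite mulr_sumr; apply: eq_bigr => k _.
  by rewrite !mxE mulrC !mulrA divff// mul1r.
have [->|_] := eqVneq i j; first by rewrite mulr1 mulVf.
by rewrite !mulr0.
Qed.

Lemma lagrange_basis_unique (l : {ffun 'I_m -> {poly_m R}}) :
  unisolvent s -> is_lagrange_basis s l -> l = lagrange_basis s.
Proof.
move=> us hl; have hl' := lagrange_basisP us.
case: us => nd [u ub Mu]; set M := (M in M \in _) in Mu.
have L0 k : seg_length (s k) != 0.
  by rewrite /seg_length subr_eq0 gt_eqF//; case: (nd k).
apply/ffunP => i; apply/eqP; rewrite -subr_eq0; apply/eqP.
set d := _ - _.
have d0 j : seg_int (s j) d = 0.
  have -> : (d : {poly R}) = (l i : {poly R}) + (-1) *: (lagrange_basis s i : {poly R}).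
    by rewrite scaleN1r.
  rewrite seg_intD seg_intZ; apply: (mulfI (invr_neq0 (L0 i))).
  by rewrite mulrDr mulrCA hl hl' mulr0 mulN1r subrr.
have dE := coord_basis ub (memvf d).
have c0 : \col_j coord u j d = 0.
  rewrite -[LHS](mulKmx Mu).
  suff -> : M *m (\col_j coord u j d) = 0 by rewrite mulmx0.
  apply/matrixP => k z; rewrite !mxE.
  transitivity ((seg_length (s k))^-1 * seg_int (s k) d); last by rewrite d0 mulr0.
  rewrite {2}dE seg_int_lin mulr_sumr; apply: eq_bigr => j _.
  by rewrite !mxE (tnth_nth 0) -mulrA (mulrC (seg_int _ _)).
rewrite dE big1// => j _.
by have /matrixP/(_ j ord0) := c0; rewrite !mxE => ->; rewrite scale0r.
Qed.

End LagrangeBasis.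

(* Main.v *)
Require Import Defs.
From HB Require Import structures.
From mathcomp Require Import all_boot all_order all_algebra.
From mathcomp Require Import all_classical all_reals all_analysis.
From mathcomp Require Import ring lra.

Set Implicit Arguments.
Unset Strict Implicit.
Unset Printing Implicit Defensive.

Import Order.TTheory GRing.Theory Num.Theory.
Import numFieldNormedType.Exports.
Local Open Scope classical_set_scope.
Local Open Scope ring_scope.

(** Bounding the Lebesgue constant by C amounts to showing that a polynomial p
of degree at most m - 1 whose averages over the m segments are at most 1 in
absolute value is bounded by C on [-1, 1]: choose signs for the Lagrange
polynomials so that all the absolute values add up (lebesgue_constant_le).
Unisolvence is the same estimate with averages equal to 0.  Everywhere p is
written P' with P a polynomial of degree at most m, so that integrals of p are
increments of P.

Exact Chebyshev segments (chebyshev_segments_bound).  Put x = - cos t, so that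
the nodes have angles k pi / m, and assume that the increment of P between
consecutive nodes is at most A times the length of the segment; then this holds
between any two nodes.  One identity carries the argument: with
tau_i = (2 i + 1) pi / (2 m), the sum over i < m of (-1)^i sin (l tau_i)
vanishes for l < m and is m for l = m (alternating_sin_sum0,
alternating_sin_sumT).  It gives
- the interpolation formula of M. Riesz (riesz_interpolation), which expresses
  P'(- cos t) sin t by differences of the values of P at - cos (t + tau_i) and
  - cos (t - tau_i), with coefficients whose absolute values add up to m / 2.
  Bernstein's inequality follows (bernstein).  When t is itself some tau_j, all
  these points are nodes, and the growth condition on P bounds |P'| by A times a
  harmonic sum (deriv_midpoint_le);
- the vanishing of the alternating sum of q over the nodes, the two endpoints
  having weight 1/2, for q of degree less than m.  For q = (P - P(x_j)) / (X - x_j)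
  the value at x_k is the average of p between x_j and x_k, and the value at x_j
  is p(x_j).  Consecutive averages differ by at most 2 A times an increment of
  ln |x_k - x_j|, and these increments telescope (alternating_slope_bound,
  deriv_node_le).
So |p| is at most a multiple of A (1 + ln m) at the 2 m + 1 angles j pi / (2 m).
By Bernstein's inequality |p| varies by at most pi / 4 < 1 times its maximum
between an angle and the closest point of this grid, so that the bound extends
to [-1, 1] at the price of a factor 1 / (1 - pi / 4) (norm_le_cheb_grid).

Mock-Chebyshev segments (mock_chebyshev_segments_bound).  Let M be the maximum
of |p|.  Moving the endpoints by at most 1 / n changes each integral by at most
2 M / n, and the Chebyshev segments are at least 1 / (2 m^2) long.  So the
averages of p over the Chebyshev segments are at most 1 + 8 m^2 M / n, unless
M <= 1.  The Chebyshev estimate and the lower bound on n turn this into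
M <= c (ln m + pi / 2) + alpha M. *)

(** * Trigonometric sums at odd multiples of pi / (2 m) *)

Section TrigonometricSums.
Variable R : realType.
Implicit Types (v t : R) (m l i k : nat).

Lemma sin_natpi k : sin (k%:R * pi : R) = 0.
Proof.
elim: k => [|k IH]; first by rewrite mul0r sin0.
by rewrite -natr1 mulrDl mul1r sinDpi IH oppr0.
Qed.

Lemma cos_natpi k : cos (k%:R * pi : R) = (-1) ^+ k.
Proof.
elim: k => [|k IH]; first by rewrite mul0r cos0.
by rewrite -natr1 mulrDl mul1r cosDpi IH exprS mulN1r.
Qed.

(** Multiplication by 2 cos v turns each term into
(-1)^i (sin ((2 i + 2) v) + sin (2 i v)), and the sum telescopes. *)
Lemma cos_mul_alternating_sin v k :
  2 * cos v * \sum_(i < k) (-1) ^+ i * sin (i.*2.+1%:R * v) =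
  - (-1) ^+ k * sin (k.*2%:R * v).
Proof.
elim: k => [|k IH]; first by rewrite big_ord0 mul0r sin0 !mulr0.
rewrite big_ord_recr /= mulrDr IH doubleS.
have -> : k.*2%:R * v = k.*2.+1%:R * v - v by rewrite -[k.*2.+1%:R]natr1; ring.
have -> : k.*2.+2%:R * v = k.*2.+1%:R * v + v by rewrite -[k.*2.+2%:R]natr1; ring.
rewrite sinB sinD exprS; ring.
Qed.

(** Half of the angular spacing pi / m of the nodes: nodes and midpoints are both
integer multiples of it. *)
Definition half_step m : R := pi / (2 * m%:R).

Lemma half_step_gt0 m : (0 < m)%N -> 0 < half_step m.
Proof. by move=> m0; rewrite divr_gt0 ?pi_gt0// mulr_gt0// ltr0n. Qed.

Lemma muln_half_step m : (0 < m)%N -> m%:R * half_step m = pi / 2.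
Proof. by rewrite -(ltr0n R) /half_step => m0; field; rewrite gt_eqF. Qed.

Lemma double_half_step m : (0 < m)%N -> m.*2%:R * half_step m = pi.
Proof.
by move=> m0; rewrite -muln2 natrM mulrAC muln_half_step// divfK.
Qed.

(** The angle halfway between two consecutive nodes; the cosines of these angles
are the zeros of the Chebyshev polynomial of degree m. *)
Definition odd_angle m i : R := i.*2.+1%:R * half_step m.

Lemma mul_odd_angle m i : (0 < m)%N ->
  m%:R * odd_angle m i = i%:R * pi + pi / 2.
Proof.
move=> m0; rewrite /odd_angle mulrCA muln_half_step//.
by rewrite -natr1 -muln2 natrM; lra.
Qed.

Lemma sin_mul_odd_angle m i : (0 < m)%N ->
  sin (m%:R * odd_angle m i) = (-1) ^+ i.
Proof. by move=> m0; rewrite mul_odd_angle// sinDpihalf cos_natpi. Qed.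

Lemma cos_mul_odd_angle m i : (0 < m)%N -> cos (m%:R * odd_angle m i) = 0.
Proof. by move=> m0; rewrite mul_odd_angle// cosDpihalf sin_natpi oppr0. Qed.

Lemma half_odd_angle_itv m i : (i < m)%N ->
  0 < odd_angle m i / 2 < pi / 2.
Proof.
move=> im; have m0 : (0 < m)%N by exact: leq_ltn_trans im.
have h0 := half_step_gt0 m0.
apply/andP; split; first by rewrite divr_gt0// mulr_gt0.
rewrite ltr_pM2r// -(double_half_step m0) ltr_pM2r// ltr_nat.
by rewrite -doubleS leq_double.
Qed.

Lemma sin_half_odd_angle_gt0 m i : (i < m)%N -> 0 < sin (odd_angle m i / 2).
Proof. by move=> im; apply: sin_gt0_pihalf; exact: half_odd_angle_itv. Qed.

(** Discrete orthogonality, since (-1)^i = sin (m tau_i).  In the closed form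
above the right-hand side is a multiple of sin (l pi) = 0, and the factor
cos (l pi / (2 m)) does not vanish because l < m. *)
Lemma alternating_sin_sum0 m l : (l < m)%N ->
  \sum_(i < m) (-1) ^+ i * sin (l%:R * odd_angle m i) = 0.
Proof.
move=> lm; have m0 : (0 < m)%N by exact: leq_ltn_trans lm.
have := cos_mul_alternating_sin (l%:R * half_step m) m.
have -> : m.*2%:R * (l%:R * half_step m) = l%:R * pi.
  by rewrite mulrCA double_half_step.
rewrite sin_natpi mulr0 => /eqP; rewrite mulf_eq0 => /orP[|/eqP].
  rewrite mulf_eq0 pnatr_eq0/= gt_eqF//.
  apply: cos_gt0_pihalf; apply/andP; split.
    rewrite (@lt_le_trans _ _ 0)// ?oppr_lt0 ?divr_gt0 ?pi_gt0//.
    by rewrite mulr_ge0// ltW ?half_step_gt0.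
  by rewrite -(muln_half_step m0) ltr_pM2r ?half_step_gt0// ltr_nat.
by under eq_bigr do rewrite mulrCA.
Qed.

Lemma alternating_sin_sumT m : (0 < m)%N ->
  \sum_(i < m) (-1) ^+ i * sin (m%:R * odd_angle m i) = m%:R.
Proof.
move=> m0; under eq_bigr do rewrite sin_mul_odd_angle// -expr2 sqrr_sign.
by rewrite sumr_const card_ord.
Qed.

(** The coefficients of the interpolation formula of M. Riesz, without signs. *)
Definition riesz_weight m i : R := (4 * m%:R * sin (odd_angle m i / 2) ^+ 2)^-1.

Lemma riesz_weight_gt0 m i : (i < m)%N -> 0 < riesz_weight m i.
Proof.
move=> im; have m0 : (0 < m)%N by exact: leq_ltn_trans im.
by rewrite invr_gt0 !mulr_gt0 ?ltr0n// sin_half_odd_angle_gt0.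
Qed.

Let rsum m l := \sum_(i < m) (-1) ^+ i * riesz_weight m i * (2 * sin (l%:R * odd_angle m i)).

Lemma cos_half_sin t : cos t = 1 - 2 * sin (t / 2) ^+ 2.
Proof.
have -> : cos t = cos ((t / 2) *+ 2) by congr cos; rewrite mulr2n; lra.
rewrite cos_mulr2n cos2sin2 mulr2n; ring.
Qed.

Let rsum_diff m l : (0 < m)%N ->
  rsum m l.+2 - 2 * rsum m l.+1 + rsum m l =
  - (2 / m%:R) * \sum_(i < m) (-1) ^+ i * sin (l.+1%:R * odd_angle m i).
Proof.
move=> m0; rewrite /rsum !mulr_sumr -sumrB -big_split/=; apply: eq_bigr => i _.
set t := odd_angle m i.
have -> : l.+2%:R * t = l.+1%:R * t + t by rewrite -[l.+2%:R]natr1; ring.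
have -> : l%:R * t = l.+1%:R * t - t by rewrite -[l.+1%:R]natr1; ring.
rewrite sinD sinB /riesz_weight -/t [cos t]cos_half_sin.
have st : sin (t / 2) != 0 by rewrite gt_eqF// sin_half_odd_angle_gt0.
have mn : m%:R != 0 :> R by rewrite pnatr_eq0 -lt0n.
by field; rewrite mn st.
Qed.

(** As a function of l, the left-hand side has second difference
- (2 / m) times the alternating sum of sin (l tau_i), hence 0 for l < m: it is
linear in l on [0, m].  At l = m the second difference is -2, while the values
at m - 1 and m + 1 agree because cos (m tau_i) = 0; so the slope is 1. *)
Lemma riesz_weight_sin m l : (l <= m)%N ->
  \sum_(i < m) (-1) ^+ i * riesz_weight m i * (2 * sin (l%:R * odd_angle m i))
  = l%:R.
Proof.
case: m => [|m]; first by rewrite leqn0 => /eqP ->; rewrite big_ord0.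
rewrite -/(rsum _ _) => lm.
have r0 : rsum m.+1 0 = 0.
  by rewrite /rsum big1// => i _; rewrite mul0r sin0 !mulr0.
have rl : forall k, (k <= m)%N ->
    rsum m.+1 k = k%:R * rsum m.+1 1 /\ rsum m.+1 k.+1 = k.+1%:R * rsum m.+1 1.
  elim=> [|k IH] km; first by rewrite r0 mul0r mul1r.
  have [e1 e2] := IH (ltnW km); split=> //.
  have := @rsum_diff m.+1 k isT; rewrite alternating_sin_sum0// mulr0 e1 e2.
  rewrite -[k.+2%:R]natr1 -[k.+1%:R]natr1; lra.
have [em emS] := rl _ (leqnn m).
have rm2 : rsum m.+1 m.+2 = rsum m.+1 m.
  apply: eq_bigr => i _; set t := odd_angle _ _.
  have -> : m.+2%:R * t = m.+1%:R * t + t by rewrite -[m.+2%:R]natr1; ring.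
  have -> : m%:R * t = m.+1%:R * t - t by rewrite -[m.+1%:R]natr1; ring.
  by rewrite sinD sinB cos_mul_odd_angle// mul0r subr0 addr0.
have r1 : rsum m.+1 1 = 1.
  have := @rsum_diff m.+1 m isT; rewrite alternating_sin_sumT// rm2 em emS.
  rewrite mulNr divfK ?pnatr_eq0// -natr1; lra.
by case: l lm => [|l] lm; [rewrite r0|rewrite (rl l _).2// r1 mulr1].
Qed.

(** The case l = m of the preceding lemma, where the sines cancel the signs; this
is what makes Bernstein's inequality sharp. *)
Lemma sum_riesz_weight m : (0 < m)%N -> \sum_(i < m) 2 * riesz_weight m i = m%:R.
Proof.
move=> m0; rewrite -[RHS](riesz_weight_sin (leqnn m)).
apply: eq_bigr => i _; rewrite sin_mul_odd_angle// mulrAC mulrCA -expr2.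
by rewrite sqrr_sign; ring.
Qed.

End TrigonometricSums.

(** * Cosine polynomials, the Riesz formula and Bernstein's inequality *)

Section CosinePolynomials.
Variable R : realType.
Implicit Types (t : R) (m n l i k : nat) (p P : {poly R}).

Definition cosine_poly n (f : R -> R) : Prop :=
  exists a : nat -> R, forall t, f t = \sum_(l < n) a l * cos (l%:R * t).

Lemma cosine_poly_comb n (N : nat) (c : nat -> R) (f : nat -> R -> R) :
  (forall l, (l < N)%N -> cosine_poly n (f l)) ->
  cosine_poly n (fun t => \sum_(l < N) c l * f l t).
Proof.
elim: N => [|N IH] fN.
  by exists (fun=> 0) => t; rewrite big_ord0 big1// => l _; rewrite mul0r.
have [a fa] := IH (fun l lN => fN l (leqW lN)); have [b fb] := fN N (leqnn _).
exists (fun l => a l + c N * b l) => t.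
rewrite big_ord_recr/= fa fb mulr_sumr -big_split/=.
by apply: eq_bigr => l _; rewrite mulrDl mulrA.
Qed.

Lemma cosine_poly_cos n l : (l < n)%N -> cosine_poly n (fun t => cos (l%:R * t)).
Proof.
move=> ln; exists (fun k => (k == l)%:R) => t.
rewrite (bigD1 (Ordinal ln))//= eqxx mul1r big1 ?addr0// => k /negPf kl.
by move: kl; rewrite -val_eqE/= => ->; rewrite mul0r.
Qed.

Lemma cosine_polyD n f g : cosine_poly n f -> cosine_poly n g ->
  cosine_poly n (fun t => f t + g t).
Proof.
move=> fn gn.
have := @cosine_poly_comb n 2 (fun=> 1) (fun l => if l is 0 then f else g).
case=> [[|l]//|a ha]; exists a => t; rewrite -ha.
by rewrite !big_ord_recl big_ord0/= !mul1r addr0.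
Qed.

Lemma cosine_polyZ n c f : cosine_poly n f -> cosine_poly n (fun t => c * f t).
Proof.
by case=> a fa; exists (fun l => c * a l) => t; rewrite fa mulr_sumr;
  apply: eq_bigr => l _; rewrite mulrA.
Qed.

(** The product formula 2 cos t cos (l t) = cos ((l + 1) t) + cos ((l - 1) t)
raises the degree by one; for l = 0 the second frequency is |0 - 1| = 1. *)
Lemma cosine_polyM n f : cosine_poly n f -> cosine_poly n.+1 (fun t => f t * - cos t).
Proof.
case=> a fa.
have [b fb] : cosine_poly n.+1
    (fun t => \sum_(l < n) a l * (cos (l%:R * t) * - cos t)).
  apply: (@cosine_poly_comb _ n a (fun l t => cos (l%:R * t) * - cos t)) => l ln.
  have -> : (fun t => cos (l%:R * t) * - cos t) =
      fun t => - (1/2) * (cos (l.+1%:R * t) + cos (`|l - 1|%N%:R * t)).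
    apply/funext => t; have -> : l.+1%:R * t = l%:R * t + t.
      by rewrite -natr1; ring.
    have -> : cos (`|l - 1|%N%:R * t) = cos (l%:R * t - t).
      case: l {ln} => [|l]; first by rewrite mul1r -cosN; congr cos; ring.
      rewrite distnEl// subn1/=; congr cos; rewrite -natr1; ring.
    by rewrite cosD cosB; lra.
  apply/cosine_polyZ/cosine_polyD; apply: cosine_poly_cos => //.
  by case: l ln => [|l] ln; [|rewrite distnEl// subn1/= ltnS ltnW// ltnW].
by exists b => t; rewrite -fb fa mulr_suml; apply: eq_bigr => l _; rewrite mulrA.
Qed.

Lemma horner_cos n p : (size p <= n)%N -> cosine_poly n (fun t => p.[- cos t]).
Proof.
elim: n p => [|n IH] p.
  rewrite leqn0 size_poly_eq0 => /eqP ->.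
  by exists (fun=> 0) => t; rewrite horner0 big_ord0.
elim/poly_ind: p => [|p c _] sp.
  by exists (fun=> 0) => t; rewrite horner0 big1// => l _; rewrite mul0r.
have spn : (size p <= n)%N.
  move: sp; rewrite size_MXaddC; case: ifP => [/andP[/eqP -> _]|_ //].
  by rewrite size_poly0.
have -> : (fun t => (p * 'X + c%:P).[- cos t]) =
    fun t => p.[- cos t] * - cos t + c * cos (0%:R * t).
  by apply/funext => t; rewrite mul0r cos0 mulr1 !hornerE.
apply: cosine_polyD; first by apply: cosine_polyM; exact: IH.
by apply: cosine_polyZ; exact: cosine_poly_cos.
Qed.

Lemma is_derive_horner_cos p t :
  is_derive t (1 : R) (fun t => p.[- cos t]) (p^`().[- cos t] * sin t).
Proof.
have h : is_derive t (1 : R) (- cos : R -> R) (sin t).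
  by apply: is_derive_eq; rewrite opprK.
by have := is_derive1_comp (is_derive_poly p ((- cos : R -> R) t)) h; rewrite mulrC.
Qed.

(** The formula of M. Riesz for the derivative of the even trigonometric
polynomial t |-> P(- cos t).  By linearity it suffices to take cos (l t), where
the difference is - 2 sin (l t) sin (l tau_i) and riesz_weight_sin applies. *)
Lemma riesz_interpolation m P t : (size P <= m.+1)%N ->
  P^`().[- cos t] * sin t = \sum_(i < m) (-1) ^+ i * riesz_weight R m i *
    (P.[- cos (t + odd_angle R m i)] - P.[- cos (t - odd_angle R m i)]).
Proof.
move=> /horner_cos[a Pa]; transitivity (\sum_(l < m.+1) a l * (- (l%:R * sin (l%:R * t)))).
  have h1 := is_derive_horner_cos P t.
  have h2 : is_derive t (1 : R)
     (\sum_(l < m.+1) (a l \*: (cos \o ( *%R (l%:R)))) : R -> R)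
     (\sum_(l < m.+1) a l * (- (l%:R * sin (l%:R * t)))).
    apply: is_derive_sum => l; apply: is_deriveZ.
    have hl : is_derive t (1 : R) ( *%R (l%:R : R)) l%:R.
      have := is_deriveZ l%:R (is_derive_id t (1 : R)).
      by rewrite /GRing.scale/= mulr1.
    have := is_derive1_comp (is_derive_cos (l%:R * t)) hl.
    by rewrite mulNr mulrC -mulrN mulrC.
  have e : (fun t => P.[- cos t]) = (\sum_(l < m.+1) (a l \*: (cos \o ( *%R (l%:R)))) : R -> R).
    by apply/funext => s; rewrite Pa fct_sumE.
  move: h1; rewrite e => h1.
  by rewrite -(@derive_val _ _ _ _ _ _ _ h1) -(@derive_val _ _ _ _ _ _ _ h2).
under [RHS]eq_bigr => i _ do rewrite !Pa -sumrB mulr_sumr.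
rewrite exchange_big/=; apply: eq_bigr => l _.
have lm : (l <= m)%N by rewrite -ltnS.
rewrite -[X in - (X * _)](riesz_weight_sin R lm) mulr_suml -sumrN mulr_sumr.
apply: eq_bigr => i _; rewrite [_ * (t + _)]mulrDr [_ * (t - _)]mulrBr cosD cosB; ring.
Qed.

(** The derivative of t |-> P(- cos t) is bounded termwise in the Riesz formula,
where the weights add up to m / 2 and each difference is at most 2 M. *)
Lemma bernstein m P (M : R) : (size P <= m.+1)%N ->
  (forall t, `|P.[- cos t]| <= M) ->
  forall t, `|P^`().[- cos t] * sin t| <= m%:R * M.
Proof.
case: m => [|m] sP PM t; first by rewrite (riesz_interpolation t sP) big_ord0 normr0 mul0r.
rewrite (riesz_interpolation t sP) -(sum_riesz_weight R (ltn0Sn m)) mulr_suml.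
apply: le_trans (ler_norm_sum _ _ _) _; apply: ler_sum => i _.
rewrite 2!normrM normr_sign mul1r (gtr0_norm (riesz_weight_gt0 _ _))//.
rewrite [leRHS]mulrAC [leRHS]mulrC ler_wpM2l ?(ltW (riesz_weight_gt0 _ _))//.
by rewrite (le_trans (ler_normB _ _))// (le_trans (lerD (PM _) (PM _)))//; lra.
Qed.

End CosinePolynomials.

(** * Elementary inequalities *)

Section ElementaryInequalities.
Variable R : realType.
Implicit Types (a b u v w A t : R) (m : nat).

Lemma norm_increment_le (f df : R -> R) K a b :
  (forall x : R, is_derive x (1 : R) f (df x)) -> a <= b ->
  (forall x, a <= x <= b -> `|df x| <= K) -> `|f b - f a| <= K * (b - a).
Proof.
move=> fd ab dfK.
have [|c] := @MVT_segment _ f df a b ab (fun x _ => fd x).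
  apply: continuous_subspaceT => x.
  by apply: differentiable_continuous; apply/derivable1_diffP; have := fd x; case.
rewrite in_itv/= => cab ->.
by rewrite normrM (ger0_norm (_ : 0 <= b - a)) ?subr_ge0// ler_wpM2r ?subr_ge0// dfK.
Qed.

(** With sin (t / 2) = (t / 2) cos c for some c <= t / 2 <= pi / 4, this comes
from sin t = 2 sin (t / 2) cos (t / 2), since both cosines are at least the
square root of 1 / 2. *)
Lemma sin_ge_half t : 0 <= t <= pi / 2 -> t / 2 <= sin t.
Proof.
have half c : 0 <= c <= t / 2 -> t <= pi / 2 -> 0 <= cos c /\ 1 / 2 <= cos c ^+ 2.
  move=> /andP[c0 ct] tpi; have pi0 := pi_gt0 R.
  split; first by apply: cos_ge0_pihalf; lra.
  have : 0 <= cos (c *+ 2) by apply: cos_ge0_pihalf; rewrite (mulr2n c); lra.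
  by rewrite cos_mulr2n (mulr2n (cos c ^+ 2)); lra.
move=> /andP[t0 tpi].
have [||c] := @MVT_segment _ (@sin R) (@cos R) 0 (t / 2).
- by rewrite divr_ge0.
- by apply: continuous_subspaceT => x; exact: continuous_sin.
rewrite in_itv/= sin0 !subr0 => ct sint.
have -> : sin t = 2 * (cos c * cos (t / 2)) * (t / 2).
  have -> : sin t = sin ((t / 2) *+ 2) by congr sin; rewrite (mulr2n (t / 2)); lra.
  by rewrite sin_mulr2n sint -mulr_natl; ring.
have [c0 c2] := half _ ct tpi.
have [|d0 d2] := half (t / 2) _ tpi; first by rewrite lexx divr_ge0.
rewrite ler_peMl ?divr_ge0// -(@ler_pXn2r _ 2) ?nnegrE ?mulr_ge0// !exprMn expr1n.
by nra.
Qed.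

Lemma ln_increment_ge a b : 0 < a -> a <= b -> (b - a) / b <= ln b - ln a.
Proof.
move=> a0 ab; have b0 : 0 < b by exact: lt_le_trans ab.
have := @le_ln1Dx R (a / b - 1); have -> : 1 + (a / b - 1) = a / b by ring.
rewrite ln_div ?posrE//.
have -> : -1 < a / b - 1 by rewrite ltrBrDr addNr divr_gt0.
by move=> /(_ isT); rewrite mulrBl divff ?gt_eqF//; lra.
Qed.

(** Here u and v stand for the averages of a function over nested intervals of
lengths a and b, and w for its integral over the difference: then
(v - u) b = w - u (b - a), and (b - a) / b is at most an increment of ln. *)
Lemma average_increment_le A a b u v w : 0 < a -> a <= b ->
  `|u| <= A -> v * b = u * a + w -> `|w| <= A * (b - a) ->
  `|v - u| <= 2 * A * (ln b - ln a).
Proof.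
move=> a0 ab uA vb wA; have b0 : 0 < b by exact: lt_le_trans ab.
have A0 : 0 <= A by exact: le_trans uA.
apply: (@le_trans _ _ (2 * A * ((b - a) / b))); last first.
  by rewrite ler_wpM2l ?ln_increment_ge// mulr_ge0.
rewrite mulrA ler_pdivlMr// -{1}(gtr0_norm b0) -normrM.
have -> : (v - u) * b = w - u * (b - a) by rewrite mulrBl vb; ring.
rewrite (le_trans (ler_normB _ _))// -mulrA mulr_natl mulr2n lerD//.
by rewrite normrM (ger0_norm (_ : 0 <= b - a)) ?subr_ge0// ler_wpM2r ?subr_ge0.
Qed.

Lemma harmonic_sum_le m : \sum_(i < m.+1) (i.+1%:R)^-1 <= 1 + ln m.+1%:R :> R.
Proof.
elim: m => [|m IH]; first by rewrite big_ord_recl big_ord0 ln1 invr1 !addr0.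
rewrite big_ord_recr/=; have := @ln_increment_ge m.+1%:R m.+2%:R (ltr0Sn R m).
rewrite ler_nat leqnSn -natrB// subSnn => /(_ isT).
rewrite div1r => ln_inc; rewrite (le_trans (lerD IH ln_inc))//.
by rewrite (addrC (ln m.+2%:R)) addrA addrK.
Qed.

End ElementaryInequalities.

(** * Slopes with vanishing alternating sum *)

Section AlternatingSlopes.
Variable R : realType.
Implicit Types (A d w : R) (x F r : nat -> R) (m j k i : nat).

Lemma node_increment_le m x F A :
  (forall k, (k < m)%N -> x k <= x k.+1) ->
  (forall k, (k < m)%N -> `|F k.+1 - F k| <= A * (x k.+1 - x k)) ->
  forall k l, (k <= m)%N -> (l <= m)%N -> `|F l - F k| <= A * `|x l - x k|.
Proof.
move=> xm FA.
suff H k l : (k <= l <= m)%N -> x k <= x l /\ `|F l - F k| <= A * (x l - x k).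
  move=> k l km lm; have [kl|/ltnW lk] := leqP k l.
    by have [|xkl] := H k l; rewrite ?kl// (ger0_norm (_ : 0 <= x l - x k)) ?subr_ge0.
  have [|xkl] := H l k; rewrite ?lk// => FF.
  by rewrite distrC (distrC (x l)) (ger0_norm (_ : 0 <= x k - x l)) ?subr_ge0.
elim: l => [|l IH]; first by rewrite leqn0 => /andP[/eqP -> _]; rewrite !subrr normr0 mulr0.
rewrite leq_eqVlt => /andP[/predU1P[->|]]; first by rewrite !subrr normr0 mulr0.
rewrite ltnS => kl lm; have [|xkl Fkl] := IH; first by rewrite kl ltnW.
split; first exact: le_trans (xm _ lm).
have -> : F l.+1 - F k = (F l.+1 - F l) + (F l - F k) by ring.
rewrite (le_trans (ler_normD _ _))// (le_trans (lerD (FA _ lm) Fkl))//.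
by rewrite -mulrDr addrA subrK.
Qed.

(** The coefficient of r j in the alternating sum: 1 at the ends, else 2, up to
sign. *)
Let altsum_delta m j : (j <= m)%N ->
  \sum_(i < m) (-1) ^+ i * ((val i == j)%:R - (i.+1 == j)%:R) =
  (-1) ^+ j * ((j < m)%N%:R + (0 < j)%N%:R) :> R.
Proof.
have H1 n : (n <= j)%N -> \sum_(i < n) (-1) ^+ i * ((val i == j)%:R - (i.+1 == j)%:R)
    = (-1) ^+ j * ((0 < j)%N && (n == j))%:R :> R.
  elim: n => [|n IH]; first by rewrite big_ord0; case: j => [|j]; rewrite mulr0.
  move=> nj; rewrite big_ord_recr/= (IH (ltnW nj)) (ltn_eqF nj) andbF mulr0 add0r.
  have -> : (0 < j)%N by exact: leq_ltn_trans nj.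
  case: eqP => [<-|_]; rewrite /= ?exprS; ring.
elim: m => [|m IH]; first by rewrite leqn0 => /eqP ->; rewrite big_ord0 addr0 mulr0.
rewrite leq_eqVlt => /predU1P[jm|].
  by rewrite -jm H1// ltnn eqxx andbT add0r.
rewrite ltnS => jm; rewrite big_ord_recr/= IH// jm (gtn_eqF (_ : (j < m.+1)%N))// subr0.
rewrite ltn_neqAle jm andbT eq_sym; by case: eqP => [->|_] /=; ring.
Qed.

(** For k <> j, the number r k is the slope of F between x_j and x_k, at most A in
absolute value, while r j is free.  The alternating sum, in which the two end
terms have half the weight of the others, expresses r j by the other slopes.
Their consecutive differences are dominated by the increments of the
nondecreasing function phi, which is built from ln |x_k - x_j| on both sides of
j, so that the bounds telescope. *)
Lemma alternating_slope_bound m j x F r A d w :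
  (0 < m)%N -> (j <= m)%N -> 0 <= A -> 0 < d ->
  (forall k, (k < m)%N -> d <= x k.+1 - x k) -> 
  (forall k l, (k <= m)%N -> (l <= m)%N -> `|x k - x l| <= w) ->
  (forall k, (k < m)%N -> `|F k.+1 - F k| <= A * (x k.+1 - x k)) ->
  (forall k, (k <= m)%N -> r k * (x k - x j) = F k - F j) ->
  \sum_(i < m) (-1) ^+ i * (r i - r i.+1) = 0 ->
  `|r j| <= 2 * A * (1 + 2 * (ln w - ln d)).
Proof.
move=> m0 jm A0 d0 xd xw FA rF sum0.
have xmono k : (k < m)%N -> x k <= x k.+1.
  by move=> km; rewrite -subr_ge0 (le_trans (ltW d0))// xd.
have Fx := node_increment_le xmono FA.
have xgap k l : (k < l <= m)%N -> d <= x l - x k.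
  elim: l => [|l IH]; first by rewrite ltn0.
  rewrite ltnS leq_eqVlt => /andP[/predU1P[->|kl] lm]; first exact: xd.
  have /IH h : (k < l <= m)%N by rewrite kl ltnW.
  by have := xmono _ lm; lra.
have rA k : (k <= m)%N -> k != j -> `|r k| <= A.
  move=> km kj; have xkj : 0 < `|x k - x j|.
    rewrite normr_gt0; apply/negP => /eqP xx.
    have [kj'|kj'|/eqP] := ltngtP k j; last by rewrite (negPf kj).
      by have := @xgap k j; rewrite kj' jm => /(_ isT); lra.
    by have := @xgap j k; rewrite kj' km => /(_ isT); lra.
  by rewrite -(ler_pM2r xkj) -normrM rF// Fx.
(* Replacing the slope at j by 0 isolates r j in the alternating sum. *)
pose r' k := if k == j then 0 else r k.
(* The constant 1/2 - ln d makes phi increase by at least 1/2 at each of the two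
   steps that touch j, where one slope is 0 and the other at most A. *)
pose lam := 1 / 2 - ln d.
pose phi k := if (k < j)%N then - ln (x j - x k) else
  if k == j then lam else 2 * lam + ln (x k - x j).
have lnd y : d <= y -> ln d <= ln y by move=> dy; rewrite ler_ln ?posrE//; apply: lt_le_trans dy.
have step i : (i < m)%N -> `|r' i - r' i.+1| <= 2 * A * (phi i.+1 - phi i).
  move=> im; rewrite /r' /phi.
  have [ij|ij|ij] := ltngtP i j.
  - have [ij1|ij1|ij1] := ltngtP i.+1 j.
    + have e1 := rF _ (ltnW im); have e2 := rF _ im.
      have -> : - ln (x j - x i.+1) - - ln (x j - x i) = ln (x j - x i) - ln (x j - x i.+1).
        by ring.
      apply: (@average_increment_le _ A _ _ _ _ (F i.+1 - F i)).
      - by apply: lt_le_trans (@xgap _ _ _) => //; rewrite ij1.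
      - by have := xmono _ im; lra.
      - by apply: rA => //; rewrite ltn_eqF.
      - by lra.
      - by rewrite (le_trans (FA _ im))// ler_wpM2l//; lra.
    + by move: ij; rewrite ltnNge -ltnS ij1.
    + rewrite subr0; apply: le_trans (rA _ (ltnW im) _) _; first by rewrite ltn_eqF.
      rewrite -[leLHS]mulr1 -[2 * A]mulrC -mulrA ler_wpM2l//.
      have /lnd : d <= x j - x i by apply: xgap; rewrite ij jm.
      by rewrite -ij1 /lam; lra.
  - have ji1 : (j < i.+1)%N by rewrite ltnW// ltnS.
    rewrite ltnNge (ltnW ji1)/= (gtn_eqF ji1).
    have e1 := rF _ (ltnW im); have e2 := rF _ im.
    have -> : 2 * lam + ln (x i.+1 - x j) - (2 * lam + ln (x i - x j)) =
       ln (x i.+1 - x j) - ln (x i - x j) by ring.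
    rewrite distrC; apply: (@average_increment_le _ A _ _ _ _ (F i.+1 - F i)).
    - by apply: lt_le_trans (@xgap _ _ _) => //; rewrite ij ltnW.
    - by have := xmono _ im; lra.
    - by apply: rA; [exact: ltnW|rewrite gtn_eqF].
    - by lra.
    - by rewrite (le_trans (FA _ im))// ler_wpM2l//; lra.
  - rewrite -ij ltnNge leqnSn/= (gtn_eqF (ltnSn i)) sub0r normrN.
    apply: le_trans (rA _ im _) _; first by rewrite -ij gtn_eqF.
    rewrite -[leLHS]mulr1 -[2 * A]mulrC -mulrA ler_wpM2l//.
    have /lnd := xd _ im.
    by rewrite /lam; lra.
have rj : `|r j| <= `|\sum_(i < m) (-1) ^+ i * (r' i - r' i.+1)|.
  have -> : \sum_(i < m) (-1) ^+ i * (r' i - r' i.+1) =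
      - (r j * ((-1) ^+ j * ((j < m)%N%:R + (0 < j)%N%:R))).
    rewrite -altsum_delta// mulr_sumr -[LHS]subr0 -[X in _ - X = _]sum0 -sumrB -sumrN.
    apply: eq_bigr => i _; rewrite /r'.
    by case: eqP => [->|_]; case: eqP => [->|_] /=; ring.
  rewrite normrN mulrCA normrM normr_sign mul1r normrM ler_peMr//.
  rewrite -natrD normr_nat ler1n.
  by move: jm; rewrite leq_eqVlt => /predU1P[->|->]//; rewrite ltnn m0.
apply: (le_trans rj); apply: (le_trans (ler_norm_sum _ _ _)).
apply: (@le_trans _ _ (\sum_(i < m) 2 * A * (phi i.+1 - phi i))).
  by apply: ler_sum => i _; rewrite normrM normr_sign mul1r step.
rewrite -mulr_sumr ler_wpM2l ?mulr_ge0//.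
rewrite -(big_mkord xpredT (fun i => phi i.+1 - phi i)) telescope_sumr//.
have lnw k l : (k < l <= m)%N -> ln (x l - x k) <= ln w.
  move=> klm; have dd := @xgap _ _ klm; have ww : `|x l - x k| <= w.
    by case/andP: klm => kl lm; rewrite xw// (leq_trans _ lm)// ltnW.
  have x0 : 0 < x l - x k by exact: lt_le_trans dd.
  move: ww; rewrite gtr0_norm// => ww.
  by rewrite ler_ln ?posrE// (lt_le_trans x0 ww).
have dw : ln d <= ln w by apply: le_trans (lnd _ (@xgap 0%N m _)) (lnw _ _ _); rewrite ?m0 leqnn.
rewrite /phi /lam ltnNge jm/=; case: (posnP j) => [j0|j0].
  by rewrite j0 (gtn_eqF m0)//=; have := lnw 0%N m; rewrite m0 leqnn => /(_ isT); lra.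
have := lnw 0%N j; rewrite j0 jm => /(_ isT); case: eqP => [_|/eqP mj]; first by lra.
by have := lnw j m; rewrite leqnn andbT ltn_neqAle eq_sym mj jm => /(_ isT); lra.
Qed.

End AlternatingSlopes.

(** * Derivative bounds at Chebyshev-Lobatto nodes and midpoints *)

Section ChebyshevSegments.
Variable R : realType.
Variable m : nat.
Hypothesis m_gt0 : (0 < m)%N.
Implicit Types (P p q : {poly R}) (A B M t x : R) (i j k l : nat).

Local Notation h := (half_step R m).
Local Notation node := (cheb_lobatto R m).

Let h0 : 0 < h. Proof. exact: half_step_gt0. Qed.
Let mR0 : 0 < m%:R :> R. Proof. by rewrite ltr0n. Qed.
Let mh : m%:R * h = pi / 2. Proof. exact: muln_half_step. Qed.

Lemma cheb_lobattoE k : node k = - cos (k.*2%:R * h).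
Proof.
rewrite /cheb_lobatto /half_step -muln2 natrM; congr (- cos _).
by field; rewrite gt_eqF.
Qed.

Lemma cheb_lobatto_increment k :
  node k.+1 - node k = 2 * (sin (odd_angle R m k) * sin h).
Proof.
rewrite !cheb_lobattoE.
have -> : k.+1.*2%:R * h = odd_angle R m k + h.
  by rewrite /odd_angle doubleS -[k.*2.+2%:R]natr1; ring.
have -> : k.*2%:R * h = odd_angle R m k - h.
  by rewrite /odd_angle -[k.*2.+1%:R]natr1; ring.
by rewrite cosD cosB; ring.
Qed.

Lemma half_step_ge : m%:R^-1 <= h.
Proof.
rewrite /half_step invfM mulrA ler_peMl ?invr_ge0 ?(ltW mR0)//.
exact: pihalf_ge1.
Qed.

(** The length of the segment is 2 sin (tau_k) sin (pi / (2 m)), and tau_k is at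
distance at least pi / (2 m) from both 0 and pi. *)
Lemma cheb_lobatto_gap k : (k < m)%N -> (2 * m%:R ^+ 2)^-1 <= node k.+1 - node k.
Proof.
move=> km; rewrite cheb_lobatto_increment.
have hpi : h <= pi / 2 by rewrite -mh ler_peMl ?(ltW h0)// ler1n.
have sinh : h / 2 <= sin h by apply: sin_ge_half; rewrite hpi (ltW h0).
have sinodd : h / 2 <= sin (odd_angle R m k).
  have /andP[odd0 oddpi] := half_odd_angle_itv R km.
  have hodd : h <= odd_angle R m k by rewrite ler_peMl ?(ltW h0)// ler1n.
  have oddh : odd_angle R m k <= pi - h.
    rewrite -(double_half_step R m_gt0) lerBrDr /odd_angle -[X in _ + X]mul1r -mulrDl.
    by rewrite ler_pM2r// natr1 ler_nat -doubleS leq_double.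
  have [odd_le|odd_gt] := leP (odd_angle R m k) (pi / 2).
    by apply: le_trans (sin_ge_half _); lra.
  have -> : sin (odd_angle R m k) = sin (pi - odd_angle R m k).
    by rewrite sinB sinpi cospi; ring.
  by apply: le_trans (sin_ge_half _); lra.
have hh : m%:R^-1 / 2 * (m%:R^-1 / 2) <= sin (odd_angle R m k) * sin h.
  have m2 : m%:R^-1 / 2 <= h / 2 by rewrite ler_pM2r// half_step_ge.
  have m20 : 0 <= m%:R^-1 / 2 :> R by rewrite divr_ge0// invr_ge0 ltW.
  by apply: ler_pM => //; [exact: le_trans sinodd|exact: le_trans sinh].
apply: (@le_trans _ _ (2 * (m%:R^-1 / 2 * (m%:R^-1 / 2)))); last by rewrite ler_pM2l.
by rewrite le_eqVlt; apply/orP; left; apply/eqP; field; rewrite gt_eqF.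
Qed.

Lemma cheb_lobatto_le k : (k < m)%N -> node k <= node k.+1.
Proof.
move=> /cheb_lobatto_gap gap; rewrite -subr_ge0; apply: le_trans gap.
by rewrite invr_ge0 mulr_ge0// exprn_ge0// ltW.
Qed.

Lemma cheb_lobatto_itv k : -1 <= node k <= 1.
Proof. by rewrite /cheb_lobatto lerNl opprK cos_le1 lerNl cos_geN1. Qed.

(** Angles in [pi, 2 pi] are reflected to [0, pi]. *)
Lemma cheb_lobatto_fold k : (k <= m.*2)%N ->
  exists2 l, (l <= m)%N & - cos (k.*2%:R * h) = node l.
Proof.
move=> k2m; have [km|mk] := leqP k m; first by exists k; rewrite ?cheb_lobattoE.
exists (m.*2 - k)%N; first by rewrite leq_subLR -addnn leq_add2r ltnW.
rewrite cheb_lobattoE doubleB natrB ?leq_double// mulrBl.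
have -> : m.*2.*2%:R * h = pi *+ 2.
  by rewrite -muln2 natrM mulrAC double_half_step// mulr_natr.
by rewrite cosB cos2pi sin2pi mul1r mul0r addr0.
Qed.

Lemma norm_odd_angleB i j :
  `|odd_angle R m i - odd_angle R m j| = `|i - j|%N.*2%:R * h.
Proof.
wlog ij : i j / (i <= j)%N => [wl|].
  by have [/wl//|/ltnW/wl] := leqP i j; rewrite distrC distnC.
rewrite distrC distnEr// doubleB natrB ?leq_double// /odd_angle -mulrBl.
rewrite -!natr1 opprD addrACA subrr addr0 ger0_norm// mulr_ge0 ?(ltW h0)//.
by rewrite subr_ge0 ler_nat leq_double.
Qed.

(** On cos (l t) with l < m, consecutive nodes differ by
2 sin (l tau_i) sin (l pi / (2 m)), so this is alternating_sin_sum0. *)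
Lemma alternating_node_sum q : (size q <= m)%N ->
  \sum_(i < m) (-1) ^+ i * (q.[node i] - q.[node i.+1]) = 0.
Proof.
move=> /horner_cos[a qa].
under eq_bigr => i _ do rewrite !cheb_lobattoE !qa -sumrB mulr_sumr.
rewrite exchange_big big1//= => l _.
transitivity (a l * (2 * sin (l%:R * h)) *
    \sum_(i < m) (-1) ^+ i * sin (l%:R * odd_angle R m i)).
  rewrite mulr_sumr; apply: eq_bigr => i _.
  have -> : l%:R * (i.*2%:R * h) = l%:R * odd_angle R m i - l%:R * h.
    by rewrite /odd_angle -[i.*2.+1%:R]natr1; ring.
  have -> : l%:R * (i.+1.*2%:R * h) = l%:R * odd_angle R m i + l%:R * h.
    by rewrite /odd_angle doubleS -[i.*2.+2%:R]natr1; ring.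
  by rewrite cosB cosD; ring.
by rewrite alternating_sin_sum0// mulr0.
Qed.

Section Bound.
Variables (P : {poly R}) (A : R).
Hypothesis sP : (size P <= m.+1)%N.
Hypothesis A0 : 0 <= A.
Hypothesis PA : forall k, (k < m)%N ->
  `|P.[node k.+1] - P.[node k]| <= A * (node k.+1 - node k).

Let Pnode k l : (k <= m)%N -> (l <= m)%N ->
  `|P.[node l] - P.[node k]| <= A * `|node l - node k|.
Proof. exact: (@node_increment_le R m node (fun k => P.[node k]) A cheb_lobatto_le PA). Qed.

Let ln_m_ge0 : 0 <= ln m%:R :> R. Proof. by rewrite ln_ge0// ler1n. Qed.

(** At the angle t = tau_j the points t + tau_i and t - tau_i of the Riesz formula
are nodes, with - cos (t + tau_i) + cos (t - tau_i) = 2 sin t sin tau_i.  The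
factor sin t cancels, and what remains of the weight, cot (tau_i / 2) / m, is
bounded by 4 / (i + 1). *)
Lemma deriv_midpoint_le j : (j < m)%N ->
  `|P^`().[- cos (odd_angle R m j)]| <= 4 * A * (1 + ln m%:R).
Proof.
move=> jm; set t := odd_angle R m j.
have st : 0 < sin t.
  by apply: sin_gt0_pi; have := half_odd_angle_itv R jm; rewrite -/t; lra.
rewrite -(ler_pM2r st) -{1}(gtr0_norm st) -normrM (riesz_interpolation _ sP).
apply: le_trans (ler_norm_sum _ _ _) _.
apply: (@le_trans _ _ (\sum_(i < m) 4 * A * sin t * i.+1%:R^-1)); last first.
  rewrite -mulr_sumr mulrAC ler_pM2r// ler_wpM2l ?mulr_ge0//.
  by case: (m) m_gt0 => // m' _; exact: harmonic_sum_le.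
apply: ler_sum => i _; set s := odd_angle R m i.
rewrite 2!normrM normr_sign mul1r (gtr0_norm (riesz_weight_gt0 _ _))//.
have [k km ek] : exists2 k, (k <= m)%N & - cos (t + s) = node k.
  have -> : t + s = (j + i).+1.*2%:R * h.
    rewrite /t /s /odd_angle -mulrDl -natrD; congr (_%:R * _).
    by rewrite addSn addnS doubleS doubleD.
  by apply: cheb_lobatto_fold; rewrite -addnn -addSn leq_add// ltnW.
have [l lm el] : exists2 l, (l <= m)%N & - cos (t - s) = node l.
  have -> : cos (t - s) = cos (`|j - i|%N.*2%:R * h).
    by rewrite -cos_norm norm_odd_angleB.
  apply: cheb_lobatto_fold; rewrite -addnn.
  have [ij|/ltnW ji] := leqP i j.
    by rewrite distnEl// (leq_trans (leq_subr _ _))// ltnW// ltn_addr.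
  by rewrite distnEr// (leq_trans (leq_subr _ _))// ltnW// ltn_addr.
have := Pnode lm km; rewrite -ek -el => PP.
have ss : 0 < sin (s / 2) by exact: sin_half_odd_angle_gt0.
have /andP[s0 spi] : 0 < s / 2 < pi / 2 := half_odd_angle_itv R (ltn_ord i).
have si : i.+1%:R / m%:R / 2 <= s / 2.
  rewrite ler_pM2r//; apply: le_trans (ler_wpM2l _ half_step_ge); rewrite ?ler0n//.
  by rewrite ler_pM2r ?invr_gt0// ler_nat ltnS -addnn leq_addr.
have sin2 : i.+1%:R / m%:R / 4 <= sin (s / 2).
  by have := @sin_ge_half R (s / 2); rewrite (ltW s0) (ltW spi) => /(_ isT); lra.
have dcos : `|- cos (t + s) - - cos (t - s)| = 4 * sin t * (sin (s / 2) * cos (s / 2)).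
  have e : - cos (t + s) - - cos (t - s) = 4 * sin t * (sin (s / 2) * cos (s / 2)).
    have -> : - cos (t + s) - - cos (t - s) = 2 * sin t * sin s by rewrite cosD cosB; ring.
    have -> : sin s = sin ((s / 2) *+ 2) by congr sin; rewrite (mulr2n (s / 2)); lra.
    by rewrite sin_mulr2n -mulr_natl; ring.
  rewrite e ger0_norm// !mulr_ge0 ?ltW//.
  by apply: cos_gt0_pihalf; rewrite -/s; lra.
rewrite dcos in PP.
apply: le_trans (ler_wpM2l (ltW (riesz_weight_gt0 _ _)) PP) _ => //.
rewrite /riesz_weight -/s.
have -> : (4 * m%:R * sin (s / 2) ^+ 2)^-1 * (A * (4 * sin t * (sin (s / 2) * cos (s / 2))))
    = A * sin t * (cos (s / 2) * (m%:R * sin (s / 2))^-1).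
  by field; rewrite !gt_eqF.
have -> : 4 * A * sin t * i.+1%:R^-1 = A * sin t * (4 * i.+1%:R^-1) by ring.
rewrite ler_wpM2l ?mulr_ge0 ?(ltW st)//.
apply: (@le_trans _ _ (m%:R * sin (s / 2))^-1).
  by rewrite ler_piMl ?cos_le1// invr_ge0 mulr_ge0 ?ltW.
have -> : 4 * i.+1%:R^-1 = (i.+1%:R / 4)^-1 :> R by rewrite invfM invrK mulrC.
rewrite lef_pV2 ?posrE ?mulr_gt0 ?divr_gt0 ?ltr0n//.
by move: sin2; rewrite mulrAC ler_pdivrMr// [_ * m%:R]mulrC.
Qed.

(** The quotient q = (P - P(x_j)) / (X - x_j) has degree less than m, so its
alternating sum over the nodes vanishes; its value at x_k is a slope of P and
its value at x_j is P'(x_j). *)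
Lemma deriv_node_le j : (j <= m)%N ->
  `|P^`().[node j]| <= 10 * A * (1 + ln m%:R).
Proof.
move=> jm; have /factor_theorem[q Pq] : root (P - P.[node j]%:P) (node j).
  by rewrite /root !hornerE subrr.
have qP' : q.[node j] = P^`().[node j].
  have -> : P^`() = (P - P.[node j]%:P)^`() by rewrite derivB derivC subr0.
  by rewrite Pq derivM derivXsubC !hornerE subrr mulr0 add0r.
have sq : (size q <= m)%N.
  have [->|q0] := eqVneq q 0; first by rewrite size_poly0.
  have -> : (size q <= m)%N = (size (q * ('X - (node j)%:P) : {poly R})%R <= m.+1)%N.
    by rewrite size_Mmonic ?monicXsubC// size_XsubC addn2.
  rewrite -Pq.
  by rewrite (leq_trans (size_polyD _ _))// size_polyN geq_max sP (leq_trans (size_polyC_leq1 _)).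
pose d : R := (2 * m%:R ^+ 2)^-1.
have d0 : 0 < d by rewrite invr_gt0 mulr_gt0// exprn_gt0.
have := @alternating_slope_bound R m j node (fun k => P.[node k]) (fun k => q.[node k]) A d 2
  m_gt0 jm A0 d0 cheb_lobatto_gap _ PA _ (alternating_node_sum sq).
rewrite qP' => H; apply: le_trans (H _ _) _.
- move=> k l _ _; have := cheb_lobatto_itv k; have := cheb_lobatto_itv l.
  by move=> /andP[? ?] /andP[? ?]; rewrite ler_norml; lra.
- by move=> k km; have := congr1 (horner^~ (node k)) Pq; rewrite !hornerE => <-.
have l2 : ln 2 <= 1 :> R by have := @le_ln1Dx R 1; rewrite -natr1; apply; lra.
have lnd : ln d = - (ln 2 + 2 * ln m%:R).
  rewrite /d lnV ?posrE ?mulr_gt0 ?exprn_gt0// lnM ?posrE ?exprn_gt0//.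
  by rewrite lnXn// mulr_natl.
rewrite lnd; have := ln_m_ge0; have := A0; nra.
Qed.

End Bound.
End ChebyshevSegments.

(** * The estimate for Chebyshev segments *)

Section PolynomialsOnTheInterval.
Variable R : realType.
Implicit Types (P p : {poly R}) (a b x y A B M : R) (m n N j k : nat).

Lemma nearest_nat y N : 0 <= y <= N%:R ->
  exists2 j, (j <= N)%N & `|y - j%:R| <= 1 / 2.
Proof.
move=> /andP[y0 yN]; have y20 : 0 <= y + 1 / 2 by lra.
have /andP[tl tr] := truncn_itv y20; exists (Num.truncn (y + 1 / 2)).
  rewrite -ltnS -(ltr_nat R) (le_lt_trans tl)// -[ltRHS]natr1; lra.
move: tr; rewrite -[ltRHS]natr1 => tr; rewrite ler_norml; lra.
Qed.

Lemma horner_max p : exists2 c, -1 <= c <= 1 &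
  forall x, -1 <= x <= 1 -> `|p.[x]| <= `|p.[c]|.
Proof.
have [|c] := @EVT_max R (fun x => `|p.[x]|) (-1) 1 ltac:(lra).
  apply: continuous_subspaceT => x; apply: continuous_comp.
    exact: continuous_horner.
  exact: norm_continuous.
by rewrite in_itv/= => c1 cmax; exists c => // x x1; apply: cmax; rewrite in_itv.
Qed.

Lemma horner_increment_le P M a b : -1 <= a <= 1 -> -1 <= b <= 1 -> a <= b ->
  (forall x, -1 <= x <= 1 -> `|P^`().[x]| <= M) ->
  `|P.[b] - P.[a]| <= M * (b - a).
Proof.
move=> a1 b1 ab PM; apply: norm_increment_le ab _ => x ?; apply: PM; lra.
Qed.

(** Let M be the maximum of |p|, reached at the angle t.  The closest grid angle is
within pi / (4 m) of t, so Bernstein's inequality gives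
M <= B + m M (pi / (4 m)). *)
Lemma norm_le_cheb_grid m p B : (0 < m)%N -> (size p <= m.+1)%N ->
  (forall j, (j <= m.*2)%N -> `|p.[- cos (j%:R * half_step R m)]| <= B) ->
  forall x, -1 <= x <= 1 -> `|p.[x]| <= B / (1 - pi / 4).
Proof.
move=> m0 sp pB x x1; have [c c1 cmax] := horner_max p.
apply: (le_trans (cmax _ x1)); set M := `|p.[c]|.
have pi4 := pihalf_lt2 R; have pi0 := pi_gt0 R.
rewrite ler_pdivlMr; last by lra.
have h0 := half_step_gt0 R m0.
have pM t : `|p.[- cos t]| <= M by apply: cmax; rewrite lerNl opprK cos_le1 lerNl cos_geN1.
pose t := acos (- c).
have ct : cos t = - c by rewrite acosK// in_itv/=; lra.
have t0 : 0 <= t by apply: acos_ge0; lra.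
have tpi : t <= pi by apply: acos_lepi; lra.
have [|j j2m tj] := @nearest_nat (t / half_step R m) m.*2.
  by rewrite divr_ge0 ?(ltW h0)//= ler_pdivrMr// double_half_step.
have tjh : `|t - j%:R * half_step R m| <= half_step R m / 2.
  have -> : t - j%:R * half_step R m = (t / half_step R m - j%:R) * half_step R m.
    by rewrite mulrBl divfK// gt_eqF.
  by rewrite normrM (gtr0_norm h0) -ler_pdivlMr// mulrAC divff ?gt_eqF.
have ber := bernstein sp pM.
have inc a b : a <= b -> `|p.[- cos b] - p.[- cos a]| <= m%:R * M * (b - a).
  move=> ab; apply: (@norm_increment_le R (fun t => p.[- cos t])
    (fun t => p^`().[- cos t] * sin t)) ab _ => [s|s _]; last exact: ber.
  exact: is_derive_horner_cos.
have M0 : 0 <= m%:R * M by apply: mulr_ge0 => //; exact: normr_ge0.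
have near : `|p.[- cos t] - p.[- cos (j%:R * half_step R m)]| <= M * (pi / 4).
  apply: (@le_trans _ _ (m%:R * M * (half_step R m / 2))).
    have [le_tj|/ltW le_jt] := leP t (j%:R * half_step R m).
      rewrite distrC (le_trans (inc _ _ le_tj))// ler_wpM2l//.
      by apply: le_trans tjh; rewrite distrC ler_norm.
    rewrite (le_trans (inc _ _ le_jt))// ler_wpM2l//.
    by apply: le_trans tjh; rewrite ler_norm.
  have -> : m%:R * M * (half_step R m / 2) = M * (m%:R * half_step R m / 2) by ring.
  by rewrite muln_half_step//; lra.
have Mc : M = `|p.[- cos t]| by rewrite ct opprK.
have := pB j j2m; move: near; rewrite mulrBr mulr1.
have := ler_normD (p.[- cos t] - p.[- cos (j%:R * half_step R m)]) p.[- cos (j%:R * half_step R m)].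
by rewrite subrK -Mc; lra.
Qed.

(** Even multiples of pi / (2 m) are nodes and odd ones are midpoints. *)
Lemma chebyshev_segments_bound m P A : (0 < m)%N -> (size P <= m.+1)%N -> 0 <= A ->
  (forall k, (k < m)%N ->
    `|P.[cheb_lobatto R m k.+1] - P.[cheb_lobatto R m k]| <=
      A * (cheb_lobatto R m k.+1 - cheb_lobatto R m k)) ->
  forall x, -1 <= x <= 1 ->
    `|P^`().[x]| <= 10 / (1 - pi / 4) * (ln m%:R + pi / 2) * A.
Proof.
move=> m0 sP A0 PA x x1.
have lnm : 0 <= ln m%:R :> R by rewrite ln_ge0// ler1n.
have sP' : (size P^`() <= m.+1)%N by apply: leq_trans (size_poly _ _) (leq_trans (leq_pred _) sP).
have grid j : (j <= m.*2)%N ->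
    `|P^`().[- cos (j%:R * half_step R m)]| <= 10 * A * (1 + ln m%:R).
  move=> jm; have := odd_double_half j; case: (odd j) => /= je.
    rewrite -je add1n; have jm2 : (j./2 < m)%N by rewrite -ltn_double -add1n je.
    apply: le_trans (deriv_midpoint_le m0 sP A0 PA jm2) _.
    by rewrite ler_wpM2r ?addr_ge0//; lra.
  rewrite -je add0n -cheb_lobattoE//; apply: deriv_node_le => //.
  by rewrite -leq_double -[leqLHS]add0n je.
apply: le_trans (norm_le_cheb_grid m0 sP' grid x1) _.
have pi1 := pihalf_ge1 R; have pi4 := pihalf_lt2 R.
have K0 : 0 < (1 - pi / 4)^-1 :> R by rewrite invr_gt0; lra.
have -> : 10 / (1 - pi / 4) * (ln m%:R + pi / 2) * A =
   10 * A * (ln m%:R + pi / 2) / (1 - pi / 4) :> R by ring.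
by rewrite ler_pM2r// ler_wpM2l ?mulr_ge0//; lra.
Qed.

End PolynomialsOnTheInterval.

(** * The estimate for mock-Chebyshev segments *)

Section Perturbation.
Variable R : realType.
Implicit Types (P p : {poly R}) (alpha A : R) (m n : nat).

(** Eight times the constant of the Chebyshev estimate: the factor 8 absorbs the
8 m^2 M / n by which the averages change. *)
Definition cheb_const : R := 80 / (1 - pi / 4).

Lemma cheb_const_ge1 : 1 <= cheb_const.
Proof.
have pi2 := pihalf_ge1 R; have pi4 := pihalf_lt2 R.
by rewrite ler_pdivlMr; lra.
Qed.

Lemma mock_chebyshev_itv m n (x : 'I_m.+1 -> R) i : (0 < n)%N ->
  is_mock_chebyshev n x -> -1 <= x i <= 1.
Proof.
rewrite -(ltr0n R) => n0 /(_ i)[k [-> _]]; rewrite /equispaced.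
have k1 : k%:R / n%:R <= 1 :> R by rewrite ler_pdivrMr// mul1r ler_nat -ltnS.
have k0 : 0 <= k%:R / n%:R :> R by rewrite divr_ge0.
by rewrite -mulrA; lra.
Qed.

Lemma mock_chebyshev_dist m n (x : 'I_m.+1 -> R) i : (0 < n)%N ->
  is_mock_chebyshev n x -> `|x i - cheb_lobatto R m i| <= n%:R^-1.
Proof.
rewrite -(ltr0n R) => n0 /(_ i)[k [-> kmin]]; set c := cheb_lobatto R m i.
have /andP[c0 c1] := cheb_lobatto_itv R m i; rewrite -/c in c0 c1.
have [|j jn cj] := @nearest_nat R ((c + 1) / 2 * n%:R) n.
  apply/andP; split; first by rewrite mulr_ge0//; lra.
  by rewrite ler_piMl//; lra.
apply: (@le_trans _ _ `|equispaced R n j - c|).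
  have := kmin (Ordinal (n := n.+1) (m := j) jn).
  by rewrite ler_pXn2r ?nnegrE.
have -> : equispaced R n j - c = - (2 / n%:R * ((c + 1) / 2 * n%:R - j%:R)).
  by rewrite /equispaced; field; rewrite gt_eqF.
rewrite normrN normrM gtr0_norm ?divr_gt0//.
by rewrite -ler_pdivlMl ?divr_gt0// (le_trans cj)// invf_div mulrAC divff ?gt_eqF.
Qed.

Section MockChebyshev.
Variables (m n : nat) (alpha : R) (x : 'I_m.+1 -> R).
Hypothesis m_gt0 : (0 < m)%N.
Hypothesis alpha_gt0 : 0 < alpha.
Hypothesis alpha_lt1 : alpha < 1.
Hypothesis n_large : cheb_const / alpha * m%:R ^+ 2 * (ln m%:R + pi / 2) <= n%:R.
Hypothesis mock_x : is_mock_chebyshev n x.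

Local Notation L := (ln m%:R + pi / 2 : R).

Let mR0 : 0 < m%:R :> R. Proof. by rewrite ltr0n. Qed.

Let L1 : 1 <= L.
Proof.
by have := pihalf_ge1 R; have : 0 <= ln m%:R :> R; [rewrite ln_ge0// ler1n|lra].
Qed.

Let c0 : 0 < cheb_const. Proof. exact: lt_le_trans ltr01 cheb_const_ge1. Qed.

Let nR0 : 0 < n%:R :> R.
Proof.
apply: lt_le_trans n_large; apply: mulr_gt0 (lt_le_trans ltr01 L1).
by rewrite pmulr_lgt0 ?exprn_gt0// divr_gt0.
Qed.

Lemma mock_chebyshev_n_gt0 : (0 < n)%N.
Proof. by move: nR0; rewrite ltr0n. Qed.
Let n0 := mock_chebyshev_n_gt0.

Let small : cheb_const * L * (m%:R ^+ 2 / n%:R) <= alpha.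
Proof.
rewrite mulrA ler_pdivrMr// -ler_pdivrMl//; apply: le_trans n_large.
by rewrite le_eqVlt; apply/orP; left; apply/eqP; ring.
Qed.

Let gap (i : 'I_m) : (2 * m%:R ^+ 2)^-1 <= cheb_lobatto R m i.+1 - cheb_lobatto R m i.
Proof. exact: cheb_lobatto_gap. Qed.

Let close_l (i : 'I_m) : `|x (widen_ord (leqnSn m) i) - cheb_lobatto R m i| <= n%:R^-1.
Proof. exact: (mock_chebyshev_dist (widen_ord (leqnSn m) i)). Qed.

Let close_r (i : 'I_m) : `|x (lift ord0 i) - cheb_lobatto R m i.+1| <= n%:R^-1.
Proof. exact: (mock_chebyshev_dist (lift ord0 i)). Qed.

Let n_inv_gap : 2 / n%:R <= 4 * (m%:R ^+ 2 / n%:R) * (2 * m%:R ^+ 2)^-1 :> R.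
Proof. by rewrite le_eqVlt; apply/orP; left; apply/eqP; field; rewrite !gt_eqF. Qed.

(** The endpoints of a Chebyshev segment move by at most 1 / n each, and 2 / n is
less than its length. *)
Lemma mock_chebyshev_lt (i : 'I_m) : x (widen_ord (leqnSn m) i) < x (lift ord0 i).
Proof.
have := close_l i; have := close_r i; have := gap i.
rewrite !ler_norml => g /andP[? ?] /andP[? ?].
suff : 2 / n%:R < (2 * m%:R ^+ 2)^-1 :> R by lra.
apply: le_lt_trans n_inv_gap _; rewrite gtr_pMl ?invr_gt0 ?mulr_gt0 ?exprn_gt0//.
have : 80 * (m%:R ^+ 2 / n%:R) <= alpha.
  apply: le_trans small; rewrite ler_pM2r ?divr_gt0 ?exprn_gt0//.
  rewrite -[80]mulr1; apply: ler_pM => //.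
  by have := pihalf_ge1 R; have := pihalf_lt2 R => ? ?; rewrite ler_pdivlMr; lra.
have : 0 < m%:R ^+ 2 / n%:R :> R by rewrite divr_gt0 ?exprn_gt0.
set q := m%:R ^+ 2 / n%:R; move: q alpha_lt1 => q; lra.
Qed.

(** With M the maximum of |P'|, the increments of P over the Chebyshev segments are
at most A + e times their lengths, where e = 8 M m^2 / n; the lower bound on n
makes the contribution of e at most alpha M. *)
Lemma mock_chebyshev_segments_bound P A : (size P <= m.+1)%N -> 0 <= A ->
  (forall i : 'I_m, `|P.[x (lift ord0 i)] - P.[x (widen_ord (leqnSn m) i)]|
     <= A * (x (lift ord0 i) - x (widen_ord (leqnSn m) i))) ->
  forall t, -1 <= t <= 1 ->
    `|P^`().[t]| <= cheb_const / (1 - alpha) * L * A.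
Proof.
move=> sP A0 PA t t1; have [c c1 cmax] := horner_max P^`().
apply: le_trans (cmax _ t1) _; set M := `|P^`().[c]| in cmax *.
have M0 : 0 <= M by exact: normr_ge0.
have al0 : 0 < 1 - alpha by rewrite subr_gt0.
have -> : cheb_const / (1 - alpha) * L * A = cheb_const * L * A / (1 - alpha) by ring.
rewrite ler_pdivlMr//.
have cL : 1 <= cheb_const * L.
  by apply: le_trans L1 _; rewrite ler_peMl ?cheb_const_ge1// (le_trans ler01 L1).
(* If M <= A, it suffices that the constant is at least 1; otherwise the error
   (A + M) 2 / n caused by moving the endpoints is at most 4 M / n. *)
have [MA|/ltW AM] := leP M A.
  apply: (@le_trans _ _ M); first by rewrite ler_piMr// gerBl ltW.
  by apply: le_trans MA _; rewrite ler_peMl.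
have Plip a b : -1 <= a <= 1 -> -1 <= b <= 1 -> `|P.[b] - P.[a]| <= M * `|b - a|.
  move=> a1 b1; have [ab|/ltW ba] := leP a b.
    by rewrite (ger0_norm (_ : 0 <= b - a)) ?subr_ge0//; exact: horner_increment_le.
  rewrite distrC (distrC b) (ger0_norm (_ : 0 <= a - b)) ?subr_ge0//.
  exact: horner_increment_le.
set e := 8 * M * (m%:R ^+ 2 / n%:R).
have e0 : 0 <= e by rewrite !mulr_ge0 ?invr_ge0 ?exprn_ge0// ltW.
have cheb : forall k, (k < m)%N ->
    `|P.[cheb_lobatto R m k.+1] - P.[cheb_lobatto R m k]| <=
      (A + e) * (cheb_lobatto R m k.+1 - cheb_lobatto R m k).
  move=> k km; pose i := Ordinal km; have := PA i.
  have := close_l i; have := close_r i; have := gap i => /=.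
  have := Plip _ _ (mock_chebyshev_itv (widen_ord (leqnSn m) i) n0 mock_x) (cheb_lobatto_itv R m k).
  have := Plip _ _ (mock_chebyshev_itv (lift ord0 i) n0 mock_x) (cheb_lobatto_itv R m k.+1).
  set yl := x (widen_ord _ _); set yr := x (lift _ _).
  set zl := cheb_lobatto R m k; set zr := cheb_lobatto R m k.+1.
  move=> Pr Pl g dr dl Py.
  have {}Pr : `|P.[zr] - P.[yr]| <= M / n%:R.
    by apply: le_trans Pr _; rewrite ler_wpM2l// distrC.
  have {}Pl : `|P.[zl] - P.[yl]| <= M / n%:R.
    by apply: le_trans Pl _; rewrite ler_wpM2l// distrC.
  have Py2 : `|P.[yr] - P.[yl]| <= A * (zr - zl) + M * (2 / n%:R).
    apply: le_trans Py _; apply: (@le_trans _ _ (A * (zr - zl + 2 / n%:R))).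
      by apply: ler_wpM2l => //; move: dr dl; rewrite !ler_norml; lra.
    by rewrite mulrDr lerD2l ler_wpM2r// divr_ge0.
  have -> : P.[zr] - P.[zl] = (P.[zr] - P.[yr]) + (P.[yr] - P.[yl]) - (P.[zl] - P.[yl]) by ring.
  apply: le_trans (ler_normB _ _) _.
  apply: le_trans (lerD (ler_normD _ _) (lexx _)) _.
  apply: le_trans (lerD (lerD Pr Py2) Pl) _.
  have : M * (2 / n%:R) * 2 <= e * (zr - zl).
    have -> : e * (zr - zl) = 2 * M * (4 * (m%:R ^+ 2 / n%:R) * (zr - zl)) by rewrite /e; ring.
    have -> : M * (2 / n%:R) * 2 = 2 * M * (2 / n%:R) by ring.
    rewrite ler_wpM2l ?mulr_ge0//; apply: le_trans n_inv_gap _.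
    by rewrite ler_wpM2l// !mulr_ge0 ?invr_ge0 ?exprn_ge0// ltW.
  by rewrite mulrDl; lra.
have := chebyshev_segments_bound m_gt0 sP (addr_ge0 A0 e0) cheb c1.
have -> : 10 / (1 - pi / 4) = cheb_const / 8 :> R by rewrite /cheb_const; lra.
rewrite -/M => H.
suff : cheb_const / 8 * L * e <= alpha * M.
  have : 0 <= cheb_const * L * A by rewrite mulr_ge0// (le_trans _ cL).
  by move: H; rewrite mulrDr; lra.
have -> : cheb_const / 8 * L * e = cheb_const * L * (m%:R ^+ 2 / n%:R) * M.
  by rewrite /e; field; rewrite gt_eqF.
by rewrite ler_wpM2r.
Qed.

End MockChebyshev.
End Perturbation.

(** * Integrals over segments and the Lebesgue constant *)

Section SegmentIntegrals.
Variable R : realType.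
Implicit Types (p P : {poly R}) (s t : segment R).

Lemma antiderivative_exists m p : (size p <= m)%N ->
  exists2 P : {poly R}, (size P <= m.+1)%N & P^`() = p.
Proof.
move=> sp; exists (\poly_(i < m.+1) (p`_i.-1 / i%:R)); first exact: size_poly.
apply/polyP => i; rewrite coef_deriv coef_poly ltnS /=.
case: ltnP => im; last by rewrite mul0rn nth_default// (leq_trans sp).
by rewrite -[LHS]mulr_natr divfK// pnatr_eq0.
Qed.

Lemma seg_int_deriv s P : Defs.nondegenerate s ->
  seg_int s P^`() = P.[s.2] - P.[s.1].
Proof.
move=> s12; rewrite /seg_int /Rintegral.
rewrite (@continuous_FTC2 R (horner P^`()) (horner P))//.
- by apply: continuous_subspaceT => x; exact: continuous_horner.
- split.
  + by move=> x _; exact: derivable_horner.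
  + by apply: cvg_at_right_filter; exact: continuous_horner.
  + by apply: cvg_at_left_filter; exact: continuous_horner.
- by move=> x _; rewrite derivE.
Qed.

Lemma seg_int_le s p M : Defs.nondegenerate s -> in_I s ->
  (forall x, -1 <= x <= 1 -> `|p.[x]| <= M) ->
  `|seg_int s p| <= M * seg_length s.
Proof.
move=> s12 [s1 s2]; have [P _ <-] := antiderivative_exists (leqnn (size p)) => PM.
have s12' : s.1 < s.2 by [].
by rewrite seg_int_deriv//; apply: horner_increment_le PM; lra.
Qed.

Lemma poly_eq0_on_I p : (forall x, -1 <= x <= 1 -> p.[x] = 0) -> p = 0.
Proof.
move=> p0; apply: (@roots_geq_poly_eq0 _ _ [seq (i.+1%:R)^-1 | i <- iota 0 (size p)]).
- apply/allP => _ /mapP[i _ ->]; apply/eqP/p0; apply/andP; split.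
    by rewrite (@le_trans _ _ 0)// ?invr_ge0// lerN10.
  by rewrite invf_le1 ?ler1n// ltr0n.
- rewrite map_inj_uniq ?iota_uniq// => i j /invr_inj/eqP.
  by rewrite eqr_nat eqSS => /eqP.
- by rewrite size_map size_iota.
Qed.

(** In the monomial basis, a vector in the kernel of the matrix is the coefficient
vector of a polynomial all of whose averages vanish. *)
Lemma unisolvent_of_injective m (s : 'I_m -> segment R) :
  (forall i, Defs.nondegenerate (s i) /\ in_I (s i)) ->
  (forall p, (size p <= m)%N -> (forall i, seg_int (s i) p = 0) -> p = 0) ->
  unisolvent s.
Proof.
move=> nd inj; split=> //; exists (npolyX R m); first exact: npolyX_full.
rewrite -unitmx_tr -row_free_unit; apply: inj_row_free => v vM.
pose p : {poly_m R} := \sum_j v 0 j *: tnth (npolyX R m) j.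
have p0 : p = 0.
  apply: val_inj => /=; apply: inj => [|i]; first exact: size_npoly.
  rewrite seg_int_lin; have /matrixP/(_ 0 i) := vM; rewrite !mxE => vi.
  have Li : (seg_length (s i))^-1 != 0.
    by rewrite invr_eq0 subr_eq0 gt_eqF//; case: (nd i).
  apply: (mulfI Li); rewrite mulr0 -[RHS]vi mulr_sumr; apply: eq_bigr => j _.
  by rewrite !mxE mulrCA.
apply/rowP => j; rewrite mxE.
have := @coord_sum_free _ _ _ (npolyX R m) (v 0) j (npolyX_free R m).
have -> : \sum_(i < m) v 0 i *: (npolyX R m)`_i = p.
  by apply: eq_bigr => i _; rewrite (tnth_nth 0).
by rewrite p0 linear0 => ->.
Qed.

(** For a given segment t, the combination p of the Lagrange polynomials with
coefficients the signs of their integrals over t has averages 0, 1 or -1, and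
its integral over t is the sum of the absolute values. *)
Lemma lebesgue_constant_le m (s : 'I_m -> segment R) (C : R) :
  unisolvent s ->
  (forall p, (size p <= m)%N ->
    (forall i, `|seg_int (s i) p| <= seg_length (s i)) ->
    forall x, -1 <= x <= 1 -> `|p.[x]| <= C) ->
  (lebesgue_constant s <= C%:E)%E.
Proof.
move=> us bound; have lag := lagrange_basisP us.
apply: ge_ereal_sup => _ [t [nt tI] <-]; rewrite lee_fin.
have t0 : 0 < seg_length t by rewrite subr_gt0.
pose p : {poly_m R} :=
  \sum_i Num.sg (seg_int t (lagrange_basis s i)) *: lagrange_basis s i.
have intp j : seg_int (s j) p =
    Num.sg (seg_int t (lagrange_basis s j)) * seg_length (s j).
  have Lj : seg_length (s j) != 0.
    by rewrite subr_eq0 gt_eqF//; case: us => nd _; case: (nd j).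
  rewrite seg_int_lin (bigD1 j)//= big1 ?addr0 => [|i ij].
    by have := lag j j; rewrite eqxx => /(canRL (mulKf (invr_neq0 Lj))); rewrite invrK mulr1 => ->.
  have Li : (seg_length (s i))^-1 != 0.
    by rewrite invr_eq0 subr_eq0 gt_eqF//; case: us => nd _; case: (nd i).
  have := lag i j; rewrite (negPf ij) => /eqP; rewrite mulf_eq0 (negPf Li)/= => /eqP ->.
  by rewrite mulr0.
rewrite mulrC ler_pdivrMr//.
have -> : \sum_(i < m) `|seg_int t (lagrange_basis s i)| = seg_int t p.
  by rewrite seg_int_lin; apply: eq_bigr => i _; rewrite normrEsg.
apply: le_trans (ler_norm _) _; apply: seg_int_le => //; apply: bound.
  exact: size_npoly.
move=> j; rewrite intp normrM (ger0_norm (_ : 0 <= seg_length (s j))); last first.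
  by rewrite subr_ge0 ltW//; case: us => nd _; case: (nd j).
rewrite ler_piMl//; last by rewrite normr_sg; case: eqP; rewrite ?ler01.
by rewrite subr_ge0 ltW//; case: us => nd _; case: (nd j).
Qed.

End SegmentIntegrals.

(** * The Lebesgue constant of mock-Chebyshev segments *)

Theorem theorem2 (R : realType) :
  exists2 c : R, 1 <= c &
    forall (m : nat) (alpha : R) (n : nat) (x : 'I_m.+1 -> R),
      (1 <= m)%N ->
      0 < alpha -> alpha < 1 ->
      c / alpha * m%:R ^+ 2 * (ln m%:R + pi / 2) <= n%:R ->
      is_mock_chebyshev n x ->
      unisolvent (concatenated x) /\
      (lebesgue_constant (concatenated x) <=
         (c / (1 - alpha) * (ln m%:R + pi / 2))%:E)%E.
Proof.
exists (cheb_const R) => [|m alpha n x m0 a0 a1 nlarge mock]; first exact: cheb_const_ge1.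
have lt_x := mock_chebyshev_lt m0 a0 a1 nlarge mock.
have n0 := mock_chebyshev_n_gt0 m0 a0 nlarge.
have nd i : Defs.nondegenerate (concatenated x i) /\ in_I (concatenated x i).
  split; first exact: lt_x.
  by split; [have /andP[] := mock_chebyshev_itv (widen_ord (leqnSn m) i) n0 mock|
             have /andP[] := mock_chebyshev_itv (lift ord0 i) n0 mock].
have bound (A : R) (p : {poly R}) : (size p <= m)%N -> 0 <= A ->
    (forall i, `|seg_int (concatenated x i) p| <= A * seg_length (concatenated x i)) ->
    forall t, -1 <= t <= 1 ->
      `|p.[t]| <= cheb_const R / (1 - alpha) * (ln m%:R + pi / 2) * A.
  move=> /antiderivative_exists[P sP <-] A0 PA.
  apply: (mock_chebyshev_segments_bound m0 a0 a1 nlarge mock sP A0) => i.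
  by have := PA i; rewrite seg_int_deriv//; case: (nd i).
have us : unisolvent (concatenated x).
  apply: unisolvent_of_injective => // p sp p0; apply: poly_eq0_on_I => t t1.
  apply/eqP; rewrite -normr_le0.
  have := bound 0 p sp (lexx 0) _ t t1; rewrite mulr0; apply=> i.
  by rewrite p0 normr0 mul0r.
split=> //; apply: lebesgue_constant_le => // p sp p1 t t1.
by have := bound 1 p sp ler01 _ t t1; rewrite mulr1; apply=> i; rewrite mul1r.
Qed.
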